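(* Let $m,n\in\mathbb{N}=\{1,2,3,\ldots\}$, let $d\ge 0$ be an integer, let $\mathbf{x}\in[n+1]^m$, and let $\mathbf{x}'=(x_1',x_2',\ldots,x_m')$ be the rearrangement of $\mathbf{x}$ into nondecreasing order. Then $\mathbf{x}$ is a defective parking function with defect $d$ (i.e. $\mathbf{x}\in\mathrm{DPF}_{m,n,d}$) if and only if \[\max\Big(\max_{j\in[m]}\big(x_j'-j+(m-n)\big),\,0\Big)=d.\]
   Context: $[n]=\{1,\ldots,n\}$. A preference list is a tuple $\mathbf{x}=(x_1,\ldots,x_m)\in[n+1]^m$. Cars $1,2,\ldots,m$ arrive in order at an infinitely long one-way street with spots numbered $1,2,3,\ldots$; car $i$ drives to spot $x_i$ and parks there if it is empty, and otherwise parks in the first empty spot after $x_i$. The spots $1,\ldots,n$ constitute the parking lot. The defect $\mathrm{dft}(\mathbf{x})$ is the number of cars that park in a spot numbered greater than $n$ (equivalently, the number of cars that fail to park in the lot under the classical parking scheme). $\mathrm{DPF}_{m,n,d}$ denotes the set of $\mathbf{x}\in[n+1]^m$ with $\mathrm{dft}(\mathbf{x})=d$. *)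

(* Defs.v *)
From mathcomp Require Import all_boot all_order all_algebra.
Import Order.TTheory GRing.Theory Num.Theory.

Lemma ex_empty_spot (occ : seq nat) (a : nat) :
  exists s, (a <= s) && (s \notin occ).
Proof.
exists (a + (sumn occ).+1); rewrite leq_addr /=; apply/negP => occ_s.
have : a + (sumn occ).+1 <= sumn occ.
  elim: occ {a}(a + _) occ_s => // b occ IH s; rewrite inE /=.
  by case/predU1P=> [->|/IH/leq_trans->//]; rewrite ?leq_addr ?leq_addl.
by apply/negP; rewrite -ltnNge addnS ltnS leq_addl.
Qed.

(* [occ] lists the occupied spots; the street is the set of positive naturals,
   so spot 0 is never reached because preferences are at least 1. *)
Definition first_empty_spot (occ : seq nat) (a : nat) : nat :=
  ex_minn (ex_empty_spot occ a).

(* Entry i (counting from 0) is the spot in which car i+1 parks. *)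
Definition parking_outcome (x : seq nat) : seq nat :=
  foldl (fun occ a => rcons occ (first_empty_spot occ a)) [::] x.

Definition dft (n : nat) (x : seq nat) : nat :=
  count (fun s => n < s) (parking_outcome x).

Definition pref_list (m n : nat) : pred (m.-tuple nat) :=
  fun x => all (fun a => 1 <= a <= n.+1) x.

Definition DPF (m n d : nat) : pred (m.-tuple nat) :=
  fun x => (x \in pref_list m n) && (dft n x == d).

(* Only meaningful for nonempty [s]: the seed is then a member of [s], so no
   extra value enters the maximum. *)
Definition maxz (s : seq int) : int :=
  \big[Num.max/head 0%R s]_(a <- s) a.

(* Main.v *)
Require Import Defs.
From mathcomp Require Import all_boot all_order all_algebra.
From mathcomp Require Import zify.
Import Order.TTheory GRing.Theory Num.Theory.

(** Fix a spot [b <= n].  Cars preferring a spot beyond [b] park beyond [b], and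
    only [n - b] of them fit in the lot, so the defect is at least
    [#{i | b < x_i} - (n - b)].  Equality holds when [b] is the last empty spot
    of the lot (with [b = 0] if the lot is full): no car drives past a spot that
    stays empty, and the spots [b + 1, ..., n] are all taken.  So the defect is
    the maximum of these numbers over [b].  Since [b < x'_(j+1)] says that at
    most [j] cars prefer a spot [<= b], the same [D] bound this maximum and the
    one over the order statistics. *)

Lemma count_mem_uniqC (T : eqType) (s t : seq T) :
  uniq s -> uniq t -> count [in t] s = count [in s] t.
Proof.
move=> us ut; rewrite -!size_filter; apply/perm_size/uniq_perm.
- exact: filter_uniq.
- exact: filter_uniq.
by move=> a; rewrite !mem_filter andbC.
Qed.

Lemma count_gt_iota (s : seq nat) (b n : nat) : b <= n ->
  count (ltn b) s = count (ltn n) s + count [in iota b.+1 (n - b)] s.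
Proof. by move=> bn; elim: s => //= a s ->; rewrite mem_iota; lia. Qed.

Lemma lt_nth_sorted (disp : Order.disp_t) (T : orderType disp) (a0 a : T)
    (s : seq T) (i : nat) : sorted <=%O s -> i < size s ->
  (a < nth a0 s i)%O = (count (fun c => c <= a)%O s <= i).
Proof.
move=> ss si; apply/idP/idP => [|ci]; last by apply: nth_count_gt; rewrite ?ci.
by apply: contraTT; rewrite -ltnNge -leNgt; apply: nth_count_le.
Qed.

Lemma eq_Posz_leE (z : int) (k : nat) : (0 <= z)%R ->
  (forall D : nat, (z <= D%:Z)%R = (k <= D)) -> z = k%:Z%R.
Proof.
case: z => // l _ le_lk; congr Posz; apply/eqP.
by have := le_lk k; have := le_lk l; rewrite !lez_nat !leqnn eqn_leq => <- ->.
Qed.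

Lemma maxz_le (s : seq int) (c : int) :
  s != [::] -> (maxz s <= c)%R = all (fun a => (a <= c)%R) s.
Proof.
case: s => // a s _; rewrite /maxz; apply/idP/allP => [max_c t ts|le_c].
  by apply: le_trans max_c; apply: le_bigmax_seq.
by rewrite big_seq; apply: bigmax_le => //; apply: le_c; rewrite mem_head.
Qed.

Lemma first_empty_spot_notin (occ : seq nat) (a : nat) :
  first_empty_spot occ a \notin occ.
Proof. by rewrite /first_empty_spot; case: ex_minnP => s /andP[]. Qed.

Lemma first_empty_spot_ge (occ : seq nat) (a : nat) :
  a <= first_empty_spot occ a.
Proof. by rewrite /first_empty_spot; case: ex_minnP => s /andP[]. Qed.

Lemma first_empty_spot_le (occ : seq nat) (a b : nat) :
  a <= b -> b \notin occ -> first_empty_spot occ a <= b.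
Proof.
move=> ab b_empty; rewrite /first_empty_spot; case: ex_minnP => s _; apply.
by rewrite ab.
Qed.

Lemma lt_first_empty_spot (occ : seq nat) (a b : nat) :
  b \notin occ -> (b < first_empty_spot occ a) = (b < a).
Proof.
move=> b_empty; apply/idP/idP => [|ba].
  by apply: contraTT; rewrite -!leqNgt => /first_empty_spot_le; apply.
exact: leq_trans ba (first_empty_spot_ge occ a).
Qed.

Lemma parking_outcome_rcons (x : seq nat) (a : nat) :
  parking_outcome (rcons x a) =
  rcons (parking_outcome x) (first_empty_spot (parking_outcome x) a).
Proof. by rewrite /parking_outcome foldl_rcons. Qed.

Lemma parking_outcome_uniq (x : seq nat) : uniq (parking_outcome x).
Proof.
elim/last_ind: x => // x a IH.
by rewrite parking_outcome_rcons rcons_uniq first_empty_spot_notin.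
Qed.

Lemma parking_outcome_notin0 (x : seq nat) :
  0 \notin x -> 0 \notin parking_outcome x.
Proof.
elim/last_ind: x => // x a IH.
rewrite parking_outcome_rcons !mem_rcons !inE !negb_or => /andP[a0 /IH->].
by have := first_empty_spot_ge (parking_outcome x) a; lia.
Qed.

Lemma count_gt_parking_outcome_ge (x : seq nat) (b : nat) :
  count (ltn b) x <= count (ltn b) (parking_outcome x).
Proof.
elim/last_ind: x => // x a IH.
rewrite parking_outcome_rcons -!cats1 !count_cat leq_add //= !addn0.
by case: ltnP => // /leq_trans-> //; apply: first_empty_spot_ge.
Qed.

Lemma count_gt_parking_outcome (x : seq nat) (b : nat) :
  b \notin parking_outcome x ->
  count (ltn b) (parking_outcome x) = count (ltn b) x.
Proof.
elim/last_ind: x => // x a IH.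
rewrite parking_outcome_rcons mem_rcons inE negb_or => /andP[_ b_empty].
by rewrite -!cats1 !count_cat IH //= lt_first_empty_spot.
Qed.

Lemma count_gt_parking_outcome_dft (n : nat) (x : seq nat) (b : nat) : b <= n ->
  count (ltn b) (parking_outcome x) =
  dft n x + count [in parking_outcome x] (iota b.+1 (n - b)).
Proof.
move=> bn; rewrite (count_gt_iota _ _ _ bn); congr (_ + _).
exact: count_mem_uniqC _ _ _ (parking_outcome_uniq x) (iota_uniq _ _).
Qed.

Lemma dft_ge (n : nat) (x : seq nat) (b : nat) : b <= n ->
  count (ltn b) x - (n - b) <= dft n x.
Proof.
move=> bn; rewrite leq_subLR addnC.
apply: leq_trans (count_gt_parking_outcome_ge x b) _.
rewrite (count_gt_parking_outcome_dft _ x _ bn) leq_add2l.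
by rewrite -[leqRHS](size_iota b.+1) count_size.
Qed.

Lemma ex_last_empty_spot (n : nat) (x : seq nat) : 0 \notin x ->
  exists b, [/\ b <= n, b \notin parking_outcome x &
                {subset iota b.+1 (n - b) <= parking_outcome x}].
Proof.
move=> /parking_outcome_notin0 x0.
have ex_empty : exists b, (b <= n) && (b \notin parking_outcome x) by exists 0.
have empty_le b : (b <= n) && (b \notin parking_outcome x) -> b <= n.
  by case/andP.
case: (ex_maxnP ex_empty empty_le) => b /andP[bn bx] b_max.
exists b; split=> //.
move=> t; rewrite mem_iota => tb; apply: contraT => tx.
by have := b_max t; rewrite tx andbT; lia.
Qed.

Lemma dft_bigmax (n : nat) (x : seq nat) : 0 \notin x ->
  dft n x = \max_(b < n.+1) (count (ltn b) x - (n - b)).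
Proof.
move=> x0; apply/eqP; rewrite eqn_leq; apply/andP; split; last first.
  by apply/bigmax_leqP => b _; apply: dft_ge; rewrite -ltnS.
have [b [bn b_empty /allP full]] := ex_last_empty_spot n x x0.
have -> : dft n x = count (ltn b) x - (n - b).
  rewrite -count_gt_parking_outcome // (count_gt_parking_outcome_dft _ x _ bn).
  by move: full; rewrite all_count size_iota => /eqP->; rewrite addnK.
exact: (leq_bigmax (Ordinal (bn : b < n.+1))).
Qed.

Lemma lt_nth_sort_leq (x : seq nat) (b j : nat) : j < size x ->
  (b < nth 0 (sort leq x) j) = (size x <= j + count (ltn b) x).
Proof.
move=> jx; rewrite -(size_sort leq) in jx.
rewrite -[LHS]/(b < nth 0 (sort leq x) j)%O.
rewrite lt_nth_sorted ?(sort_sorted leq_total) //.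
rewrite count_sort -(count_predC (ltn b)) addnC leq_add2r.
by congr (_ <= j); apply: eq_count => c; apply: leqNgt.
Qed.

Lemma dft_le_sortP (n D : nat) (x : seq nat) :
  all (fun a => 1 <= a <= n.+1) x ->
  reflect (forall j, j < size x ->
             nth 0 (sort leq x) j + size x <= D + n + j.+1)
          (dft n x <= D).
Proof.
move=> /allP x_pref; have x0 : 0 \notin x by apply/negP => /x_pref.
rewrite dft_bigmax //.
apply: (iffP (bigmax_leqP _ _ _)) => [le_D j jx|le_D b _].
  have /x_pref : nth 0 (sort leq x) j \in x.
    by rewrite -(mem_sort leq) mem_nth ?size_sort.
  have := lt_nth_sort_leq _ (nth 0 (sort leq x) j).-1 _ jx.
  case: (nth _ _ j) => // b; rewrite ltnSn /= ltnS => size_le bn.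
  by have := le_D (Ordinal (bn : b < n.+1)) isT; rewrite /=; lia.
have count_le := count_size (ltn b) x; have bn := ltn_ord b.
case: (posnP (count (ltn b) x)) => [->//|count_gt0].
have jx : size x - count (ltn b) x < size x by lia.
by have := le_D _ jx; have := lt_nth_sort_leq _ b _ jx; lia.
Qed.

Theorem theorem1p2 (m n d : nat) (m_gt0 : 0 < m) (n_gt0 : 0 < n)
    (x : m.-tuple nat) (hx : x \in pref_list m n) :
  let x' : m.-tuple nat := [tuple of sort leq x] in
  x \in DPF m n d <->
  Num.max (maxz [seq ((tnth x' j)%:Z - (j.+1)%:Z + (m%:Z - n%:Z))%R | j : 'I_m])
    0%R = d%:Z%R.
Proof.
move=> x'; set s := [seq _ | j : 'I_m].
have s0 : s != [::] by rewrite -size_eq0 size_map size_enum_ord -lt0n.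
suff -> : Num.max (maxz s) 0%R = (dft n x)%:Z%R.
  by rewrite /DPF unfold_in hx /=; split=> [/eqP->|[->]].
apply: eq_Posz_leE => [|D]; first by rewrite le_max lexx orbT.
rewrite ge_max lez_nat andbT maxz_le //.
apply/allP/(dft_le_sortP _ _ _ hx); rewrite size_tuple => le_D.
  move=> j jm; have := le_D _ (map_f _ (mem_enum 'I_m (Ordinal jm))).
  by rewrite (tnth_nth 0) /=; lia.
move=> _ /mapP[j _ ->].
by have := le_D j (ltn_ord j); rewrite (tnth_nth 0) /=; lia.
Qed.
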